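(* Let $\alpha$ be a real number with $\alpha-\max G\neq 0,-1,-2,\ldots$. Assume that $\Omega_G(n)\neq 0$ for $n=0,1,2,\ldots$, and let $\kappa_i^g$ ($i=0,\ldots,m-1$, $g\in G$) be real numbers such that for each $i=0,\ldots,m-1$ $$\sum_{g\in G}\kappa_i^g\mathcal{R}_g(-j)=0\quad (j=1,\ldots,m-1-i),\qquad \sum_{g\in G}\kappa_i^g\mathcal{R}_g(-m+i)\neq 0 .$$ Then, for every $n\ge 0$, the polynomials $(q_n)_n$ satisfy $$\langle q_n,q_i\rangle=0,\quad i=0,\ldots,n-1,\qquad\qquad \langle q_n,q_n\rangle\neq 0,$$ where $\langle\cdot,\cdot\rangle$ is the bilinear form (depending on the numbers $\kappa_i^g$) defined in the context.
   Context: For $\alpha\in\mathbb{R}$ the Laguerre polynomials are $L_n^{\alpha}(x)=\sum_{j=0}^n\frac{(-x)^j}{j!}\binom{n+\alpha}{n-j}$ for $n\ge 0$, and $L_n^\alpha=0$ for $n<0$. Here $\binom{y}{k}=y(y-1)\cdots(y-k+1)/k!$ and $(a)_k=a(a+1)\cdots(a+k-1)$ with $(a)_0=1$. $G=\{g_1<g_2<\cdots<g_m\}$ is a finite set of $m\ge 1$ positive integers and, for each $g\in G$, $\mathcal{R}_g$ is a real polynomial of degree $g$ with leading coefficient $1/g!$. Put $\Omega_G(x)=\det\left(\mathcal{R}_{g_l}(x-j)\right)_{l,j=1}^m$. The polynomials $(q_n)_{n\ge 0}$ are defined by $$q_n(x)=\begin{vmatrix} L^\alpha_n(x) & L^\alpha_{n-1}(x)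 & \cdots & L^\alpha_{n-m}(x)\\ \mathcal{R}_{g_1}(n)&\mathcal{R}_{g_1}(n-1)&\cdots&\mathcal{R}_{g_1}(n-m)\\ \vdots&\vdots&\ddots&\vdots\\ \mathcal{R}_{g_m}(n)&\mathcal{R}_{g_m}(n-1)&\cdots&\mathcal{R}_{g_m}(n-m)\end{vmatrix}.$$ Laguerre weight: for real $a\ne-1,-2,\ldots$, $\mu_a$ denotes the Laguerre orthogonality measure normalized by $\int_0^\infty\mu_a\,dx=\Gamma(a+1)$; it equals $x^ae^{-x}$ on $(0,\infty)$ for $a>-1$, and in general it acts on polynomials through its moments $\int_0^\infty x^k\mu_a\,dx=\Gamma(a+k+1)$, $k\ge0$. Multiplication by an integer power of $x$ (possibly negative) means $x^k\mu_a=\mu_{a+k}$, whenever $a+k\neq-1,-2,\ldots$. Write $\mathcal{R}_g(x)=\sum_{l=0}^g w_l^g\binom{x+l}{l}$ (this determines the numbers $w_l^g$ uniquely, and $w_g^g=1$). Given real numbers $\kappa_i^g$, define for $i=0,\ldots,m-1$ $$\mathfrak{U}_i(x)=\sum_{g\in G}\left(\frac{-x^{-m+i}}{m}+\kappa_i^g\sum_{l=0}^g(\alpha-l)_l\,w_l^g\,x^{-l-1}\right).$$ For $\alpha-\max G\ne0,-1,-2,\ldots$, the (in general nonsymmetric) bilinear form on real polynomials is $$\langle p,q\rangle=\int_0^\infty p(x)q(x)\mu_{\alpha-m}\,dx+\sum_{i=0}^{m-1}\frac{q^{(i)}(0)}{i!}\int_0^\infty p(x)\,\mathfrak{U}_i(x)\,\mu_\alpha\,dx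 .$$ *)

(* Defs.v *)
From HB Require Import structures.
From mathcomp Require Import all_boot all_order all_algebra.
From mathcomp Require Import all_classical all_reals all_analysis.
Import Order.TTheory GRing.Theory Num.Theory.

Set Implicit Arguments.
Unset Strict Implicit.
Unset Printing Implicit Defensive.

Local Open Scope ring_scope.

Section Defs.
Variable R : realType.
Implicit Types (a alpha x y : R) (p q : {poly R}).

Definition gbinom y (k : nat) : R := (\prod_(j < k) (y - j%:R)) / k`!%:R.

Definition pochhammer a (k : nat) : R := \prod_(j < k) (a + j%:R).

(* Euler's integral for 0 < a; for the other a, Gamma (a + n) / (a)_n with n
   the least natural number such that 0 < a + n.  The value at the poles
   a = 0, -1, -2, ... is meaningless. *)
Definition Gamma_integral a : R :=
  \int[@lebesgue_measure R]_(x in `]0, +oo[%classic)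
    (x `^ (a - 1) * expR (- x)).

Definition Gamma a : R :=
  if 0 < a then Gamma_integral a
  else let n := (Num.truncn (- a)).+1 in
    Gamma_integral (a + n%:R) / pochhammer a n.

Definition laguerre alpha (n : nat) : {poly R} :=
  \poly_(j < n.+1) ((-1) ^+ j / j`!%:R * gbinom (n%:R + alpha) (n - j)).

Definition laguerrez alpha (n : int) : {poly R} :=
  match n with Posz k => laguerre alpha k | Negz _ => 0 end.

(* laguerre_measure a p is the integral of p against mu_a, given by the moments
   of mu_a.  It is meaningful for a <> -1, -2, ... *)
Definition laguerre_measure a p : R :=
  \sum_(k < size p) p`_k * Gamma (a + k%:R + 1).

(* The integral of p against x^k mu_a = mu_(a + k). *)
Definition xpow_laguerre_measure (k : int) a p : R :=
  laguerre_measure (a + k%:~R) p.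

Variable G : seq nat.
Local Notation m := (size G).

Variable Rg : nat -> {poly R}.

Definition maxG : nat := \max_(g <- G) g.

Definition Omega x : R :=
  \det (\matrix_(l < m, j < m) (Rg (nth 0%N G l)).[x - j.+1%:R]).

Definition lagdet alpha (n : nat) : {poly R} :=
  \det (\matrix_(i < m.+1, j < m.+1)
    if i == 0%N :> nat then laguerrez alpha (n%:Z - j%:Z)
    else ((Rg (nth 0%N G i.-1)).[n%:R - j%:R])%:P).

Definition is_binomial_coeffs (w : nat -> nat -> R) : Prop :=
  forall g : nat, g \in G ->
  forall x, (Rg g).[x] = \sum_(l < g.+1) w g l * gbinom (x + l%:R) l.

Variables (alpha : R) (w kappa : nat -> nat -> R).

(* The integral of p against U_i mu_alpha, where U_i is the Laurent polynomial
     U_i(x) = \sum_(g in G) (- x^(-m+i) / m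
       + kappa_i^g \sum_(l <= g) (alpha - l)_l w_l^g x^(-l-1));
   w g l is w_l^g and kappa g i is kappa_i^g. *)
Definition U_measure (i : nat) p : R :=
  \sum_(g <- G)
    (- xpow_laguerre_measure (- m%:Z + i%:Z) alpha p / m%:R
     + kappa g i * \sum_(l < g.+1)
         pochhammer (alpha - l%:R) l * w g l
         * xpow_laguerre_measure (- l%:Z - 1) alpha p).

Definition bform p q : R :=
  laguerre_measure (alpha - m%:R) (p * q)
  + \sum_(i < m) (q^`(i)).[0] / i`!%:R * U_measure i p.

End Defs.

(* Main.v *)
Require Import Defs.
From HB Require Import structures.
From mathcomp Require Import all_boot all_order all_algebra.
From mathcomp Require Import all_classical all_reals all_analysis.
From mathcomp Require Import measurable_realfun.
From mathcomp Require Import ring lra zify.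
Import Order.TTheory GRing.Theory Num.Theory.
Import numFieldNormedType.Exports.
Local Open Scope ring_scope.

(** Expanding the determinant along its first row writes
    q_n = sum_(j <= m) b_(n,j) L_(n-j), where the cofactors b_(n,j) satisfy
    b_(n,0) = Omega(n), b_(n,m) = (-1)^m Omega(n+1), and, a determinant with
    two equal rows being zero, sum_j b_(n,j) R_g(n-j) = 0 for every g in G.
    Since Omega(n) <> 0, q_n has degree n, so the theorem amounts to
    <q_n, x^k> = 0 for k < n and <q_n, x^n> <> 0.

    For k >= m the Taylor coefficients of x^k of order < m vanish and
    <p, x^k> is the integral of p x^(k-m) against mu_alpha.  The ordinary
    orthogonality of the Laguerre polynomials kills every L_(n-j) when k < n,
    and leaves only j = m, with a nonzero value, when k = n.

    For k < m the terms - x^(-m+k) / m, one for each of the m elements of G,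
    cancel the first integral of the form.  The rest of U_k is chosen so that
    <L_N, x^k> = Gamma(alpha) sum_g kappa_k^g R_g(N) for N >= 0
    (bformXn_laguerre_lt).  If R_g(N) also gave the value for N < 0, then
    <q_n, x^k> would be zero by the relation between the cofactors; but
    L_N = 0 for N < 0, so <q_n, x^k> is minus the missing terms, in which
    R_g is evaluated at -1, ..., n-m (bformXn_lagdet_lt).  The hypotheses on
    kappa kill all these terms when k < n, and all but the last when k = n.

    Both Laguerre facts are instances of one evaluation,
    int L_n^alpha mu_beta = Gamma(beta+1) binom(n+alpha-beta-1, n), which the
    functional equation of Gamma reduces to the Chu-Vandermonde identity.  The
    functional equation for positive arguments is an integration by parts, and
    it extends to the other arguments by the definition of Gamma there. *)

Set Implicit Arguments.
Unset Strict Implicit.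
Unset Printing Implicit Defensive.

(** * Euler's integral *)

Section GammaIntegral.
Local Open Scope classical_set_scope.
Variable R : realType.
Local Notation mu := (@lebesgue_measure R).

Definition gamma_integrand (a x : R) : R := x `^ (a - 1) * expR (- x).

Lemma gamma_integrand_ge0 a x : 0 <= gamma_integrand a x.
Proof. by rewrite mulr_ge0 ?powR_ge0 ?expR_ge0. Qed.

Lemma measurable_gamma_integrand a (D : set R) :
  measurable_fun D (fun x => (gamma_integrand a x)%:E).
Proof.
apply/measurable_EFinP/measurable_funTS; apply: measurable_funM.
  exact: measurable_powR.
by apply: measurableT_comp => //; exact: measurable_expR.
Qed.

Lemma is_derive_powR_expRN (a x : R) : 0 < x ->
  is_derive x 1 (fun y : R => y `^ a * expR (- y))
    (a * gamma_integrand a x - gamma_integrand (a + 1) x).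
Proof.
move=> x0.
have dp := is_derive1_powR a x0.
have de : is_derive x 1 (fun y : R => expR (- y)) (- expR (- x)).
  apply: is_derive_eq; rewrite /GRing.scale /=; ring.
apply: is_derive_eq.
rewrite /gamma_integrand addrK /GRing.scale /=; ring.
Qed.

(** From e^y >= y at y = x / (2 a), raised to the power a.  The bound serves
    twice: it makes the boundary term at infinity vanish, and its right-hand
    side is an integrable majorant. *)
Lemma powR_expRN_le (a x : R) : 0 < a -> 0 <= x ->
  x `^ a * expR (- x) <= (2 * a) `^ a * expR (- (x / 2)).
Proof.
move=> a0 x0.
have a20 : 0 < 2 * a by rewrite mulr_gt0.
have h : x <= 2 * a * expR (x / (2 * a)).
  have := expR_ge1Dx (x / (2 * a)).
  rewrite -(ler_pM2l a20) => /(le_trans _); apply.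
  by rewrite mulrDr mulr1 mulrCA divff ?mulr1 ?gt_eqF // lerDr ltW.
have : x `^ a <= (2 * a) `^ a * expR (x / 2).
  have -> : expR (x / 2) = expR (x / (2 * a)) `^ a.
    by rewrite -expRM; congr expR; field; rewrite gt_eqF.
  rewrite -powRM ?expR_ge0 ?(ltW a20) //.
  by apply: ge0_ler_powR; rewrite ?nnegrE ?mulr_ge0 ?expR_ge0 // ltW.
rewrite -(ler_pM2r (expR_gt0 (- x))) => /le_trans; apply.
by rewrite -mulrA -expRD (_ : x / 2 + - x = - (x / 2)) //; field.
Qed.

(** Compact intervals exhausting the half-line: the integrand may be singular
    at 0, so both ends are approached by a limit.  The shift by 2 keeps the
    intervals nondegenerate. *)
Let seg n : set R := `[(n.+2%:R)^-1, n.+2%:R].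

Let seg_bounds n : (n.+2%:R)^-1 < n.+2%:R :> R.
Proof.
apply: (@lt_trans _ _ 1); last by rewrite (ltr_nat R 1).
by rewrite invf_lt1 ?ltr0n // (ltr_nat R 1).
Qed.

Let bigcup_seg : \bigcup_n seg n = `]0, +oo[.
Proof.
apply/seteqP; split=> x /=.
  case=> n _; rewrite /seg /= !in_itv /= andbT => /andP[h _].
  by apply: lt_le_trans h; rewrite invr_gt0.
rewrite in_itv /= andbT => x0.
pose k := (Num.truncn x + Num.truncn x^-1)%N.
exists k => //; rewrite /seg /= in_itv /=; apply/andP; split.
  rewrite -[leRHS]invrK lef_pV2 ?posrE ?invr_gt0 ?ltr0n //.
  apply: ltW; apply: lt_le_trans (truncnS_gt _) _.
  by rewrite ler_nat ltnS leqW // leq_addl.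
apply: ltW; apply: lt_le_trans (truncnS_gt _) _.
by rewrite ler_nat ltnS leqW // leq_addr.
Qed.

Let cvg_seg a :
  (\int[mu]_(x in seg n) (gamma_integrand a x)%:E)%E @[n --> \oo] -->
  (\int[mu]_(x in `]0%R, +oo[) (gamma_integrand a x)%:E)%E.
Proof.
rewrite -bigcup_seg; apply: ge0_nondecreasing_set_cvg_integral.
- apply/nondecreasing_seqP => n; rewrite subsetEset; apply: subset_itv.
  + by rewrite bnd_simp lef_pV2 ?posrE ?ltr0n // ler_nat.
  + by rewrite bnd_simp ler_nat.
- by move=> n; exact: measurable_itv.
- by move=> n; exact: measurable_gamma_integrand.
- by move=> n x _; rewrite lee_fin gamma_integrand_ge0.
Qed.

Let boundary a (n : nat) : R :=
  n.+2%:R `^ a * expR (- n.+2%:R)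
  - (n.+2%:R^-1) `^ a * expR (- n.+2%:R^-1).

Let cvg_invS : (n.+2%:R^-1 : R) @[n --> \oo] --> (0 : R)^'+.
Proof.
move=> A /= HA.
have h : (n.+2%:R^-1 : R) @[n --> \oo] --> (0 : R).
  by have := @cvg_harmonic R; rewrite -cvg_shiftS.
have := h _ HA; rewrite /= !nbhs_simpl /=.
by apply: filterS => n; apply; rewrite /= invr_gt0.
Qed.

Lemma cvgr_expRN_half : expR (- (x / 2)) @[x --> +oo] --> (0 : R).
Proof.
apply: (cvg_comp (fun x : R => x / 2) (fun x => expR (- x)) _ (@cvgr_expR R)).
by apply: gt0_cvgMly; [rewrite invr_gt0 | exact: cvg_id].
Qed.

Let cvg_boundary (a : R) : 0 < a -> boundary a n @[n --> \oo] --> (0 : R).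
Proof.
move=> a0; rewrite -(subr0 (0 : R)); apply: cvgB.
  apply: (@squeeze_cvgr _ _ _ _ (fun=> 0)
    (fun n => (2 * a) `^ a * expR (- (n.+2%:R / 2)))).
  - near=> n; rewrite mulr_ge0 ?powR_ge0 ?expR_ge0 //=.
    by apply: powR_expRN_le.
  - exact: cvg_cst.
  - rewrite -(mulr0 ((2 * a) `^ a)); apply: cvgMl_tmp.
    apply: (cvg_comp (fun n : nat => n.+2%:R : R) (fun x => expR (- (x / 2))) _
      cvgr_expRN_half).
    by have := @cvgr_idn R; rewrite -cvg_shiftS -cvg_shiftS.
rewrite -(mul0r (expR (- 0))); apply: cvgM.
  exact: (cvg_comp _ _ cvg_invS (powR_cvg0 a0)).
apply: (@cvg_comp _ _ _ (fun n : nat => n.+2%:R^-1 : R) (fun x => expR (- x)) _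
  (0 : R)^'+).
  exact: cvg_invS.
apply: cvg_at_right_filter.
apply: continuous_comp; [exact: continuousN | exact: continuous_expR].
Unshelve. all: by end_near. Qed.

Let in_seg_gt0 n (x : R) : x \in `[(n.+2%:R)^-1, n.+2%:R]%R -> 0 < x.
Proof.
by rewrite in_itv /= => /andP[h _]; apply: lt_le_trans h; rewrite invr_gt0.
Qed.

Let continuous_gamma_seg a n : {within seg n, continuous (gamma_integrand a)}.
Proof.
apply: derivable_within_continuous => x /in_seg_gt0 x0.
exact: (@ex_derive _ _ _ _ _ _ _ (is_derive_powR_expRN (a - 1) x0)).
Qed.

Let integrable_gamma_seg a n :
  mu.-integrable (seg n) (fun x => (gamma_integrand a x)%:E).
Proof.
apply: continuous_compact_integrable; first exact: segment_compact.
exact: continuous_gamma_seg.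
Qed.

Let by_parts a n : (a%:E * \int[mu]_(x in seg n) (gamma_integrand a x)%:E =
  \int[mu]_(x in seg n) (gamma_integrand (a + 1) x)%:E + (boundary a n)%:E)%E.
Proof.
pose f x := a * gamma_integrand a x - gamma_integrand (a + 1) x.
pose F x : R := x `^ a * expR (- x).
have cf : {within seg n, continuous f}.
  by move=> x; apply: cvgB; [apply: cvgMl_tmp|]; exact: continuous_gamma_seg.
have dF (x : R) : 0 < x -> is_derive x 1 F (f x) by exact: is_derive_powR_expRN.
have cF (x : R) : 0 < x -> {for x, continuous F}.
  move=> /dF h; apply: differentiable_continuous.
  by apply/derivable1_diffP; exact: ex_derive.
have i0 : 0 < n.+2%:R^-1 :> R by rewrite invr_gt0.
have FTC : (\int[mu]_(x in seg n) (f x)%:E = (boundary a n)%:E)%E.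
  rewrite /seg (continuous_FTC2 (seg_bounds n) cf (F := F)) -?EFinB //.
    split.
    - by move=> x /subset_itv_oo_cc /in_seg_gt0 /dF h; exact: ex_derive.
    - by apply: cvg_at_right_filter; exact: cF.
    - by apply: cvg_at_left_filter; exact: cF.
  move=> x /subset_itv_oo_cc /in_seg_gt0 /dF h.
  by rewrite derive1E derive_val.
have ifn : mu.-integrable (seg n) (fun x => (f x)%:E).
  by apply: continuous_compact_integrable => //; exact: segment_compact.
have ms : measurable (seg n) by exact: measurable_itv.
rewrite -FTC -integralD // -integralZl //.
by apply: eq_integral => x _; rewrite -EFinM -EFinD /f addrC subrK.
Qed.

(** The integrals are extended reals here, and the integrands are nonnegative,
    so the identity can be obtained by monotone limits before finiteness is
    known; finiteness is then deduced from it. *)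
Lemma gamma_integral_rec (a : R) : 0 < a ->
  (\int[mu]_(x in `]0%R, +oo[) (gamma_integrand (a + 1) x)%:E
   = a%:E * \int[mu]_(x in `]0%R, +oo[) (gamma_integrand a x)%:E)%E.
Proof.
move=> a0.
have h1 := cvgeZl (ltac:(done) : a%:E \is a fin_num) (@cvg_seg a).
have h2 : ((\int[mu]_(x in seg n) (gamma_integrand (a + 1) x)%:E
   + (boundary a n)%:E) @[n --> \oo] -->
   \int[mu]_(x in `]0%R, +oo[) (gamma_integrand (a + 1) x)%:E + 0)%E.
  apply: cvgeD; first by rewrite fin_num_adde_defl.
    exact: cvg_seg.
  by apply: cvg_EFin; [near=> n | exact: cvg_boundary].
rewrite adde0 in h2.
apply: (cvg_unique _ h2); first exact: ereal_hausdorff.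
suff -> : (fun n => \int[mu]_(x in seg n) (gamma_integrand (a + 1) x)%:E
      + (boundary a n)%:E)%E
    = (fun n => a%:E * \int[mu]_(x in seg n) (gamma_integrand a x)%:E)%E.
  exact: h1.
by apply/funext => n; rewrite by_parts.
Unshelve. all: by end_near. Qed.

Lemma gamma_integral_gt0 a :
  (0 < \int[mu]_(x in `]0%R, +oo[) (gamma_integrand a x)%:E)%E.
Proof.
rewrite lt0e integral_ge0 ?andbT; last first.
  by move=> x _; rewrite lee_fin gamma_integrand_ge0.
apply/negP => /eqP I0.
(* A zero integral would make the positive integrand vanish almost
   everywhere on a half-line of infinite measure. *)
have := (@ae_eq_integral_abs _ _ _ mu `]0%R, +oo[ (measurable_itv _)
   (fun x => (gamma_integrand a x)%:E) (@measurable_gamma_integrand a _)).1.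
case.
  rewrite -[RHS]I0; apply: eq_integral => x _.
  by rewrite gee0_abs // lee_fin gamma_integrand_ge0.
move=> N [mN N0 sN].
have : (mu `]0%R, +oo[ <= mu N)%E.
  apply: le_measure; rewrite ?inE //.
  move=> x /= xI; apply: sN => /= /(_ xI) /eqP; apply/negP.
  move: xI; rewrite in_itv /= andbT => x0.
  by rewrite eqe gt_eqF // mulr_gt0 ?powR_gt0 ?expR_gt0.
by rewrite N0 lebesgue_measure_itv /= ltry.
Qed.

(** The majorant by an exponential covers the arguments > 1; the recurrence
    transfers finiteness from a + 1 to a, where x^(a-1) may be singular. *)
Lemma gamma_integral_lty (a : R) : 0 < a ->
  (\int[mu]_(x in `]0%R, +oo[) (gamma_integrand a x)%:E < +oo)%E.
Proof.
suff h (b : R) : 0 < b ->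
    (\int[mu]_(x in `]0%R, +oo[) (gamma_integrand (b + 1) x)%:E < +oo)%E.
  move=> a0; have := h _ a0; rewrite gamma_integral_rec //.
  have := gamma_integral_gt0 a.
  case: (integral _ _ _) => [r|_|] //=; first by rewrite !ltry.
  by rewrite gt0_muley ?ltxx ?lte_fin.
move=> b0.
pose C := (2 * b) `^ b.
pose E (x : R) : R := C * expR (- (x / 2)).
have cE : continuous E.
  move=> x; apply: differentiable_continuous; apply/derivable1_diffP.
  exact: ex_derive.
have EI : (\int[mu]_(x in `[0%R, +oo[) (E x)%:E = (2 * C)%:E)%E.
  have dG (x : R) :
      is_derive x 1 (fun x : R => - 2 * C * expR (- (x / 2))) (E x).
    apply: is_derive_eq; rewrite /E /GRing.scale /=.
    by field.
  have cG : continuous (fun x : R => - 2 * C * expR (- (x / 2))).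
    move=> x; apply: differentiable_continuous; apply/derivable1_diffP.
    exact: ex_derive.
  rewrite (@ge0_continuous_FTC2y _ _
    (fun x : R => - 2 * C * expR (- (x / 2))) 0 0).
  - by rewrite mul0r oppr0 expR0 mulr1 -EFinB sub0r mulNr opprK.
  - by move=> x _; rewrite mulr_ge0 ?powR_ge0 ?expR_ge0.
  - exact: continuous_subspaceT.
  - rewrite -(mulr0 (- 2 * C)); apply: cvgMl_tmp.
    exact: cvgr_expRN_half.
  - by move=> x _; exact: ex_derive.
  - by apply: cvg_at_right_filter; exact: cG.
  - by move=> x _; rewrite derive1E derive_val.
apply: (@le_lt_trans _ _ (2 * C)%:E); last by rewrite ltry.
rewrite -EI integral_itv_obnd_cbnd.
  apply: ge0_le_integral => //.
  - by move=> x _; rewrite lee_fin gamma_integrand_ge0.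
  - exact: measurable_gamma_integrand.
  - by apply/measurable_EFinP/measurable_funTS; exact: continuous_measurable_fun.
  - move=> x; rewrite /= in_itv /= andbT => x0.
    by rewrite lee_fin /gamma_integrand addrK powR_expRN_le.
exact: measurable_gamma_integrand.
Qed.

Lemma Gamma_integralE (a : R) :
  Gamma_integral a =
    fine (\int[mu]_(x in `]0%R, +oo[) (gamma_integrand a x)%:E)%E.
Proof. by []. Qed.

Lemma Gamma_integral_gt0 (a : R) : 0 < a -> 0 < Gamma_integral a.
Proof.
by move=> a0; apply: fine_gt0; rewrite gamma_integral_gt0 gamma_integral_lty.
Qed.

Lemma Gamma_integralS (a : R) : 0 < a ->
  Gamma_integral (a + 1) = a * Gamma_integral a.
Proof.
move=> a0; rewrite !Gamma_integralE gamma_integral_rec // fineM // fin_numElt.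
by rewrite gamma_integral_lty // (lt_trans _ (gamma_integral_gt0 _)).
Qed.

End GammaIntegral.

(** * The Gamma function and generalized binomial coefficients *)

Section Pochhammer.
Variable R : realType.
Implicit Types (a x y : R) (k n : nat).

Lemma pochhammer0 a : pochhammer a 0 = 1.
Proof. by rewrite /pochhammer big_ord0. Qed.

Lemma pochhammerSr a k : pochhammer a k.+1 = pochhammer a k * (a + k%:R).
Proof. by rewrite /pochhammer big_ord_recr. Qed.

Lemma pochhammerD a k n :
  pochhammer a (k + n) = pochhammer a k * pochhammer (a + k%:R) n.
Proof.
elim: n => [|n IHn]; first by rewrite addn0 pochhammer0 mulr1.
by rewrite addnS !pochhammerSr IHn natrD addrA mulrA.
Qed.

Lemma pochhammer1 k : pochhammer (1 : R) k = k`!%:R.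
Proof.
elim: k => [|k IHk]; first by rewrite pochhammer0.
by rewrite pochhammerSr IHk factS natrM nat1r mulrC.
Qed.

Definition not_pole a := forall k, a <> - k%:R.

Lemma not_poleDn a k : not_pole a -> not_pole (a + k%:R).
Proof.
by move=> h j e; apply: (h (k + j)%N); rewrite natrD; lra.
Qed.

Lemma pochhammer_neq0 a k : not_pole a -> pochhammer a k != 0.
Proof.
move=> h; apply/prodf_neq0 => j _; apply/eqP => /eqP.
by rewrite addr_eq0 => /eqP; apply: h.
Qed.

Lemma Gamma_integralD a k : 0 < a ->
  Gamma_integral (a + k%:R) = pochhammer a k * Gamma_integral a.
Proof.
move=> a0; elim: k => [|k IHk]; first by rewrite addr0 pochhammer0 mul1r.
rewrite -natr1 addrA Gamma_integralS ?IHk ?pochhammerSr; first by ring.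
by rewrite ltr_wpDr.
Qed.

(** Any shift n making a + n positive computes Gamma a, not only the least one
    used in its definition: the quotient F below does not depend on n. *)
Lemma Gamma_pochhammer a n : not_pole a -> 0 < a + n%:R ->
  Gamma_integral (a + n%:R) = pochhammer a n * Gamma a.
Proof.
move=> ha an0.
pose F j := Gamma_integral (a + j%:R) / pochhammer a j.
have Fconst i j : 0 < a + i%:R -> F (i + j)%N = F i.
  move=> ai; rewrite /F natrD addrA (Gamma_integralD j ai) pochhammerD.
  by field; rewrite !pochhammer_neq0 //; exact: not_poleDn.
have [N [aN ->]] : exists N, 0 < a + N%:R /\ Gamma a = F N.
  rewrite /Gamma; case: ifP => a0.
    by exists 0%N; rewrite /F addr0 pochhammer0 divr1.
  exists (Num.truncn (- a)).+1; split=> //.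
  by have := truncnS_gt (- a); lra.
by rewrite -(Fconst _ n) // addnC Fconst // mulrC divfK ?pochhammer_neq0.
Qed.

Lemma GammaD a k : not_pole a -> Gamma (a + k%:R) = pochhammer a k * Gamma a.
Proof.
move=> ha; pose n := (Num.truncn (- a)).+1.
have an : 0 < a + n%:R by have := truncnS_gt (- a); rewrite -/n; lra.
have h := @not_poleDn a k ha.
apply: (mulfI (pochhammer_neq0 n h)).
have akn : 0 < a + k%:R + n%:R by rewrite addrAC ltr_wpDr.
rewrite -(Gamma_pochhammer h akn) mulrA [X in _ = X * _]mulrC -pochhammerD.
by rewrite -addrA -natrD Gamma_pochhammer // natrD addrA.
Qed.

Lemma Gamma_neq0 a : not_pole a -> Gamma a != 0.
Proof.
move=> ha; pose n := (Num.truncn (- a)).+1.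
have an : 0 < a + n%:R by have := truncnS_gt (- a); rewrite -/n; lra.
have := Gamma_integral_gt0 an; rewrite Gamma_pochhammer // => /lt0r_neq0.
by rewrite mulf_eq0 negb_or => /andP[].
Qed.

Lemma gbinom0 x : gbinom x 0 = 1.
Proof. by rewrite /gbinom big_ord0 fact0 divr1. Qed.

Lemma gbinomS x k : k.+1%:R * gbinom x k.+1 = (x - k%:R) * gbinom x k.
Proof.
rewrite /gbinom big_ord_recr /= factS natrM.
by field; rewrite nat1r !pnatr_eq0 -lt0n fact_gt0.
Qed.

Lemma gbinomN x k : gbinom (- x) k = (-1) ^+ k * pochhammer x k / k`!%:R.
Proof.
rewrite /gbinom /pochhammer; congr (_ / _).
rewrite -[in (-1) ^+ k](card_ord k) -prodrN.
by apply: eq_bigr => i _; rewrite opprD.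
Qed.

Lemma gbinom_nat n k : gbinom n%:R k = 'C(n, k)%:R :> R.
Proof.
have kf : k`!%:R != 0 :> R by rewrite pnatr_eq0 -lt0n fact_gt0.
apply: (mulIf kf); rewrite -natrM bin_ffact /gbinom divfK // {kf}.
elim: k => [|k IHk]; first by rewrite big_ord0 ffactn0.
rewrite big_ord_recr /= IHk ffactnSr natrM.
have [kn|nk] := leqP k n; first by rewrite natrB.
by rewrite ffact_small // !mul0r.
Qed.

(** Chu-Vandermonde, by induction on n: multiplying by n + 1 and splitting
    x + y - n as (x - j) + (y - (n - j)) in the j-th term, each half shifts one
    of the two binomials, and the terms recombine with weight
    j + (n + 1 - j) = n + 1. *)
Lemma gbinom_Vandermonde x y n :
  \sum_(j < n.+1) gbinom x j * gbinom y (n - j) = gbinom (x + y) n.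
Proof.
elim: n => [|n IHn]; first by rewrite big_ord1 !gbinom0 mulr1.
have n0 : n.+1%:R != 0 :> R by rewrite pnatr_eq0.
apply: (mulfI n0); rewrite gbinomS -IHn !mulr_sumr.
transitivity (\sum_(j < n.+2) (j%:R * gbinom x j * gbinom y (n.+1 - j)
   + gbinom x j * ((n.+1 - j)%:R * gbinom y (n.+1 - j)))).
  apply: eq_bigr => -[j jn] _ /=.
  by rewrite natrB; last (by rewrite -ltnS); ring.
rewrite big_split /= big_ord_recl /= !mul0r add0r.
rewrite [X in _ + X]big_ord_recr /= subnn mul0r mulr0 addr0 -big_split /=.
apply: eq_bigr => -[j jn] _ /=; rewrite ltnS in jn.
by rewrite gbinomS subSS subSn // gbinomS natrB //; ring.
Qed.

End Pochhammer.

(** * Integrals of Laguerre polynomials *)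

Section LaguerreMeasure.
Variable R : realType.
Implicit Types (a alpha beta : R) (p q : {poly R}).

Lemma laguerre_measureE a p N : (size p <= N)%N ->
  laguerre_measure a p = \sum_(k < N) p`_k * Gamma (a + k%:R + 1).
Proof.
move=> pN; rewrite /laguerre_measure.
rewrite (big_ord_widen _ (fun k => p`_k * Gamma (a + k%:R + 1)) pN).
rewrite big_mkcond /=; apply: eq_bigr => i _; case: ifPn => // h.
by rewrite nth_default ?mul0r // leqNgt.
Qed.

Lemma laguerre_measure_is_linear a : scalar (laguerre_measure a).
Proof.
move=> c p q; pose N := maxn (size p) (size q).
rewrite !(@laguerre_measureE _ _ N) ?leq_maxl ?leq_maxr //; last first.
  by apply: leq_trans (size_polyD _ _) _; rewrite geq_max leq_maxr andbT
    (leq_trans (size_scale_leq _ _)) // leq_maxl.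
rewrite mulr_sumr -big_split /=; apply: eq_bigr => i _.
by rewrite coefD coefZ; ring.
Qed.

HB.instance Definition _ a := GRing.isLinear.Build R {poly R} R _
  (laguerre_measure a) (laguerre_measure_is_linear a).

Lemma laguerre_measureMXn a p k :
  laguerre_measure a (p * 'X^k) = laguerre_measure (a + k%:R) p.
Proof.
rewrite (@laguerre_measureE _ _ (k + size p)); last first.
  by apply: leq_trans (size_polyMleq _ _) _; rewrite size_polyXn addnC addSn.
rewrite big_split_ord /= big1 ?add0r => [|i _]; last first.
  by rewrite coefMXn ltn_ord mul0r.
rewrite /laguerre_measure; apply: eq_bigr => i _.
by rewrite coefMXn ltnNge leq_addr /= addKn natrD addrA.
Qed.

(** The j-th moment contributes
    (-1)^j (beta + 1)_j / j! = binom(- (beta + 1), j), so that the integral is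
    a Chu-Vandermonde sum. *)
Lemma laguerre_measure_laguerre alpha beta n : not_pole (beta + 1) ->
  laguerre_measure beta (laguerre alpha n)
  = Gamma (beta + 1) * gbinom (n%:R + alpha - (beta + 1)) n.
Proof.
move=> hb; rewrite (@laguerre_measureE _ _ n.+1) ?size_poly //.
rewrite [_ - _]addrC -gbinom_Vandermonde mulr_sumr; apply: eq_bigr => j _.
rewrite coef_poly ltn_ord addrAC GammaD // gbinomN.
by field; rewrite pnatr_eq0 -lt0n fact_gt0.
Qed.

Lemma laguerrez_sub alpha (n j : nat) : laguerrez alpha (n%:Z - j%:Z) =
  if (j <= n)%N then laguerre alpha (n - j) else 0.
Proof.
case: leqP => [jn|nj]; first by rewrite subzn.
by rewrite -opprB subzn ?(ltnW nj) // -(subnSK nj) -NegzE.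
Qed.

Lemma size_laguerre alpha n : (size (laguerre alpha n) <= n.+1)%N.
Proof. exact: size_poly. Qed.

Lemma lead_laguerre alpha n : (laguerre alpha n)`_n != 0.
Proof.
by rewrite coef_poly ltnSn subnn gbinom0 mulr1 mulf_neq0 ?signr_eq0 //.
Qed.

End LaguerreMeasure.

(** * Expansion of the determinant *)

Section Lagdet.
Variables (R : realType) (G : seq nat) (Rg : nat -> {poly R}) (alpha : R).
Local Notation m := (size G).
Hypothesis G_gt0 : (0 < m)%N.

(** Its cofactors along row 0 are those of the determinant defining q_n;
    i.-1 aligns row i with the i-th element of G. *)
Definition lagdet_mx (n : nat) : 'M[R]_m.+1 :=
  \matrix_(i, j) (Rg (nth 0%N G i.-1)).[n%:R - j%:R].

Definition lagdet_coef n j : R := cofactor (lagdet_mx n) ord0 j.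

Lemma lagdetE n : lagdet G Rg alpha n =
  \sum_(j < m.+1) lagdet_coef n j *: laguerrez alpha (n%:Z - j%:Z).
Proof.
rewrite /lagdet (expand_det_row _ ord0); apply: eq_bigr => j _.
rewrite mxE /= mulrC -mul_polyC; congr (_ * _).
rewrite /lagdet_coef /cofactor polyCM rmorphXn rmorphN1; congr (_ * _).
rewrite -det_map_mx; congr (\det _); apply/matrixP => i k.
by rewrite !mxE.
Qed.

(** The sum is the determinant obtained by putting the row of g, which occurs
    further down, in place of row 0. *)
Lemma lagdet_coef_orthogonal n g : g \in G ->
  \sum_(j < m.+1) lagdet_coef n j * (Rg g).[n%:R - j%:R] = 0.
Proof.
move=> gG; have ig : ((index g G).+1 < m.+1)%N by rewrite ltnS index_mem.
pose A : 'M[R]_m.+1 := \matrix_(i, j) if i == ord0 then (Rg g).[n%:R - j%:R]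
  else lagdet_mx n i j.
have detA : \det A = 0.
  apply: (@determinant_alternate _ _ A ord0 (Ordinal ig)) => // j.
  by rewrite !mxE /= nth_index.
rewrite -[RHS]detA (expand_det_row _ ord0); apply: eq_bigr => j _.
rewrite mxE eqxx mulrC; congr (_ * _).
rewrite /lagdet_coef /cofactor; congr (_ * \det _).
by apply/matrixP => i k; rewrite !mxE.
Qed.

Lemma lagdet_coef0 n : lagdet_coef n ord0 = Omega G Rg n%:R.
Proof.
rewrite /lagdet_coef /cofactor expr0 mul1r; congr (\det _).
by apply/matrixP => i k; rewrite !mxE.
Qed.

Lemma lagdet_coef_max n :
  lagdet_coef n ord_max = (-1) ^+ m * Omega G Rg n.+1%:R.
Proof.
rewrite /lagdet_coef /cofactor; congr (_ * \det _).
apply/matrixP => i k; rewrite !mxE lift_max /=.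
by congr horner; rewrite -[n.+1%:R]natr1 -[k.+1%:R]natr1; ring.
Qed.

Hypothesis Omega_neq0 : forall n : nat, Omega G Rg n%:R <> 0.

Lemma size_lagdet n : (size (lagdet G Rg alpha n) <= n.+1)%N.
Proof.
rewrite lagdetE; apply: (big_ind (fun p : {poly R} => size p <= n.+1)%N).
- by rewrite size_poly0.
- by move=> p q ps qs; apply: leq_trans (size_polyD _ _) _; rewrite geq_max ps.
move=> j _; apply: leq_trans (size_scale_leq _ _) _.
rewrite laguerrez_sub; case: ifP => _; last by rewrite size_poly0.
by apply: leq_trans (size_laguerre _ _) _; rewrite ltnS leq_subr.
Qed.

Lemma lead_lagdet n : (lagdet G Rg alpha n)`_n != 0.
Proof.
rewrite lagdetE big_ord_recl coefD lagdet_coef0 coefZ laguerrez_sub /= subn0.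
rewrite coef_sum big1 ?addr0 => [|j _].
  by rewrite mulf_neq0 ?lead_laguerre //; apply/eqP.
rewrite coefZ laguerrez_sub; case: ifP => [h|_]; last by rewrite coef0 mulr0.
rewrite nth_default ?mulr0 // (leq_trans (size_laguerre _ _)) //.
by rewrite /bump /= add1n in h *; rewrite ltn_subrL (leq_trans _ h).
Qed.

(** * The form on monomials *)

Variables w kappa : nat -> nat -> R.
Hypothesis Rg_w : is_binomial_coeffs G Rg w.

Local Notation form := (bform G alpha w kappa).

Lemma derivnXn_horner0 k i : (('X^k)^`(i)).[0] / i`!%:R = (i == k)%:R :> R.
Proof.
rewrite horner_coef0 coef_derivn coefXn addn0 ffactnn -[_ *+ i`!]mulr_natr.
by rewrite mulfK // pnatr_eq0 -lt0n fact_gt0.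
Qed.

Lemma bform_is_linear p : scalar (form p).
Proof.
move=> c q r; rewrite /bform mulrDr -scalerAr linearP /=.
rewrite mulrDr -!addrA; congr (_ + _); rewrite addrCA; congr (_ + _).
rewrite mulr_sumr -big_split /=; apply: eq_bigr => i _.
by rewrite derivnD derivnZ hornerD hornerZ; ring.
Qed.

HB.instance Definition _ p := GRing.isLinear.Build R {poly R} R _
  (form p) (bform_is_linear p).

Lemma bformXn p k : form p 'X^k =
  laguerre_measure (alpha - m%:R + k%:R) p
  + (if (k < m)%N then U_measure G alpha w kappa k p else 0).
Proof.
rewrite /bform laguerre_measureMXn; congr (_ + _).
under eq_bigr => i _ do rewrite derivnXn_horner0.
case: ltnP => km.
  rewrite (bigD1 (Ordinal km)) //= eqxx mul1r big1 ?addr0 // => i ik.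
  by rewrite (_ : (_ == _) = false) ?mul0r //; apply: negbTE.
by apply: big1 => i _; rewrite ltn_eqF ?mul0r // (leq_trans (ltn_ord i)).
Qed.

Lemma bformXn_ge p k : (m <= k)%N ->
  form p 'X^k = laguerre_measure (alpha + (k - m)%:R) p.
Proof.
move=> mk; rewrite bformXn ltnNge mk addr0 natrB //.
by congr laguerre_measure; ring.
Qed.

(** The term of U_k containing - x^(-m+k) / m occurs once for each of the m
    elements of G, and so cancels the first integral of the form. *)
Lemma bformXn_lt p k : (k < m)%N -> form p 'X^k =
  \sum_(g <- G) kappa g k * \sum_(l < g.+1)
    pochhammer (alpha - l%:R) l * w g l * laguerre_measure (alpha - l.+1%:R) p.
Proof.
move=> km; rewrite bformXn km /U_measure big_split /= /xpow_laguerre_measure.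
rewrite big_const_seq count_predT -Monoid.iteropE -[iterop _ _ _ _]/(_ *+ _).
rewrite addrA (_ : _ + _ *+ m = 0) ?add0r.
  apply: eq_bigr => g _; congr (_ * _); apply: eq_bigr => l _.
  by congr (_ * laguerre_measure _ _); rewrite rmorphB rmorphN /= -natr1; ring.
have m0 : m%:R != 0 :> R by rewrite pnatr_eq0 -lt0n.
by rewrite -[(_ / _) *+ m]mulr_natr divfK // rmorphD rmorphN /= addrA subrr.
Qed.

(** Naming the functional lets it carry a linear structure, so that it can be
    distributed over the expansion of the determinant. *)
Definition bform_moment k p := form p 'X^k.

Lemma bform_moment_is_linear k : scalar (bform_moment k).
Proof.
move=> c p q; rewrite /bform_moment.
have [mk|km] := leqP m k; first by rewrite !bformXn_ge // linearP.
rewrite !bformXn_lt // mulr_sumr -big_split /=; apply: eq_bigr => g _.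
rewrite mulrCA -mulrDr; congr (_ * _); rewrite mulr_sumr -big_split /=.
by apply: eq_bigr => l _; rewrite linearP /=; ring.
Qed.

HB.instance Definition _ k := GRing.isLinear.Build R {poly R} R _
  (bform_moment k) (bform_moment_is_linear k).

Lemma bformXn_lagdet n k : form (lagdet G Rg alpha n) 'X^k =
  \sum_(j < m.+1) lagdet_coef n j *
    (if (j <= n)%N then form (laguerre alpha (n - j)) 'X^k else 0).
Proof.
rewrite -/(bform_moment k _) lagdetE linear_sum; apply: eq_bigr => j _.
rewrite linearZ /= laguerrez_sub; congr (_ * _).
by case: ifP => // _; rewrite linear0.
Qed.

Hypothesis alphaG : forall k : nat, alpha - (maxG G)%:R <> - k%:R.

Lemma not_pole_subG l : (l <= maxG G)%N -> not_pole (alpha - l%:R).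
Proof.
move=> lG k e; apply: (alphaG (k := (k + (maxG G - l))%N)).
by rewrite natrD natrB //; lra.
Qed.

Lemma not_pole_alpha : not_pole alpha.
Proof. by rewrite -[alpha]subr0; exact: (@not_pole_subG 0%N). Qed.

Lemma bformXn_laguerre_ge N k : (m <= k)%N ->
  form (laguerre alpha N) 'X^k
  = Gamma (alpha + (k - m).+1%:R) * gbinom (N%:R - (k - m).+1%:R) N.
Proof.
move=> mk; rewrite bformXn_ge //.
have e : alpha + (k - m)%:R + 1 = alpha + (k - m).+1%:R by rewrite -addrA natr1.
have h : not_pole (alpha + (k - m)%:R + 1).
  by rewrite e; apply: not_poleDn; exact: not_pole_alpha.
rewrite laguerre_measure_laguerre // e.
by congr (_ * gbinom _ _); ring.
Qed.

(** With s = k - m < N, the binomial coefficient is binom(N - s - 1, N) with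
    0 <= N - s - 1 < N. *)
Lemma bformXn_laguerre_gt N k : (m <= k < m + N)%N ->
  form (laguerre alpha N) 'X^k = 0.
Proof.
move=> /andP[mk kN]; rewrite bformXn_laguerre_ge //.
have h : ((k - m).+1 <= N)%N by rewrite -subSn // leq_subLR.
by rewrite -natrB // gbinom_nat bin_small ?mulr0 // ltn_subrL (leq_trans _ h).
Qed.

(** The binomial coefficient is now binom(-1, N) = (-1)^N. *)
Lemma bformXn_laguerre_eq N :
  form (laguerre alpha N) 'X^(m + N) != 0.
Proof.
rewrite bformXn_laguerre_ge ?leq_addr // addKn.
have -> : N%:R - N.+1%:R = - 1 :> R by rewrite -natr1; ring.
rewrite gbinomN pochhammer1 mulfK ?pnatr_eq0 -?lt0n ?fact_gt0 //.
rewrite mulf_neq0 ?signr_eq0 // Gamma_neq0 //.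
by apply: not_poleDn; exact: not_pole_alpha.
Qed.

(** The factor (alpha - l)_l turns the value Gamma (alpha - l) binom(N + l, l)
    of the l-th integral into Gamma alpha binom(N + l, l), and the w_l^g are
    the coordinates of R_g on these binomial coefficients. *)
Lemma bformXn_laguerre_lt N k : (k < m)%N ->
  form (laguerre alpha N) 'X^k
  = Gamma alpha * \sum_(g <- G) kappa g k * (Rg g).[N%:R].
Proof.
move=> km; rewrite bformXn_lt // mulr_sumr !big_seq; apply: eq_bigr => g gG.
rewrite [RHS]mulrCA; congr (_ * _); rewrite Rg_w // mulr_sumr.
apply: eq_bigr => l _.
have lG : (l <= maxG G)%N.
  rewrite (leq_trans (ltn_ord l : (l <= g)%N)) // /maxG.
  exact: leq_bigmax_seq.
have hl := not_pole_subG lG.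
have e : alpha - l.+1%:R + 1 = alpha - l%:R by rewrite -natr1; ring.
have N_l : N%:R + alpha - (alpha - l%:R) = (N + l)%:R by rewrite natrD; ring.
have hl' : not_pole (alpha - l.+1%:R + 1) by rewrite e.
rewrite laguerre_measure_laguerre // e N_l.
rewrite -natrD !gbinom_nat -[in LHS]bin_sub ?leq_addr // addKn.
rewrite -[in Gamma alpha](subrK l%:R alpha) GammaD //.
by ring.
Qed.

(** * Orthogonality *)

Hypothesis kappa_eq0 : forall i : nat, (i < m)%N ->
   forall j : nat, (1 <= j <= m - 1 - i)%N ->
   \sum_(g <- G) kappa g i * (Rg g).[- j%:R] = 0.
Hypothesis kappa_neq0 : forall i : nat, (i < m)%N ->
   \sum_(g <- G) kappa g i * (Rg g).[- m%:R + i%:R] <> 0.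

(** The sum over all j vanishes because the cofactors are orthogonal to every
    R_g; the indices j <= n are those with a nonzero Laguerre polynomial, and
    their contribution is therefore the opposite of that of the others. *)
Lemma bformXn_lagdet_lt n k : (k < m)%N ->
  form (lagdet G Rg alpha n) 'X^k = - Gamma alpha *
    \sum_(j < m.+1 | (n < j)%N) lagdet_coef n j *
       \sum_(g <- G) kappa g k * (Rg g).[n%:R - j%:R].
Proof.
move=> km; pose S j := \sum_(g <- G) kappa g k * (Rg g).[n%:R - j%:R].
have S0 : \sum_(j < m.+1) lagdet_coef n j * S j = 0.
  under eq_bigr => j _ do rewrite mulr_sumr.
  rewrite exchange_big /= big_seq big1 // => g gG.
  under eq_bigr => j _ do rewrite mulrCA.
  by rewrite -mulr_sumr lagdet_coef_orthogonal ?mulr0.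
transitivity (Gamma alpha * \sum_(j < m.+1 | ~~ (n < j)%N) lagdet_coef n j * S j).
  rewrite bformXn_lagdet [in RHS]big_mkcond mulr_sumr.
  apply: eq_bigr => j _; rewrite -leqNgt; case: ifP => jn; last by rewrite !mulr0.
  by rewrite bformXn_laguerre_lt // natrB // mulrCA.
move: S0; rewrite (bigID (fun j : 'I_m.+1 => n < j)%N) /= => /eqP.
by rewrite addr_eq0 => /eqP ->; rewrite mulrNN.
Qed.

(** In the case k < m, the points n - j with n < j <= m lie between
    - (m - 1 - k) and -1 because k < n, within the range where the kappa
    combinations vanish. *)
Lemma bformXn_lagdet_eq0 n k : (k < n)%N -> form (lagdet G Rg alpha n) 'X^k = 0.
Proof.
move=> kn; have [mk|km] := leqP m k.
  rewrite bformXn_lagdet big1 // => j _; case: ifP => jn; last by rewrite mulr0.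
  by rewrite bformXn_laguerre_gt ?mulr0 // mk /=; have := ltn_ord j; lia.
rewrite bformXn_lagdet_lt // big1 ?mulr0 // => j nj.
have -> : n%:R - j%:R = - (j - n)%:R :> R by rewrite natrB ?opprB // ltnW.
by rewrite kappa_eq0 ?mulr0 //; have := ltn_ord j; lia.
Qed.

(** Whether n is at least m or not, only the term j = m survives; its cofactor
    is Omega (n + 1) up to sign. *)
Lemma bformXn_lagdet_neq0 n : form (lagdet G Rg alpha n) 'X^n != 0.
Proof.
have [mn|nm] := leqP m n.
  rewrite bformXn_lagdet big_ord_recr /= big1 ?add0r => [|j _]; last first.
    case: ifP => jn; last by rewrite mulr0.
    by rewrite bformXn_laguerre_gt ?mulr0 // mn /=; have := ltn_ord j; lia.
  rewrite mn lagdet_coef_max -[in X in 'X^X](subnKC mn) !mulf_neq0 ?signr_eq0 //.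
    exact/eqP.
  exact: bformXn_laguerre_eq.
rewrite bformXn_lagdet_lt // (bigD1 ord_max) //=.
rewrite [X in _ + X]big1 ?addr0 => [|j /andP[nj jm]].
  rewrite lagdet_coef_max !mulf_neq0 ?oppr_eq0 ?signr_eq0 //.
  - exact/Gamma_neq0/not_pole_alpha.
  - exact/eqP.
  - by rewrite [_ - _]addrC; apply/eqP/kappa_neq0.
have -> : n%:R - j%:R = - (j - n)%:R :> R by rewrite natrB ?opprB // ltnW.
rewrite kappa_eq0 ?mulr0 //; move: jm; rewrite -val_eqE /=.
by have := ltn_ord j; lia.
Qed.

(** As q_n is orthogonal to the lower powers of x, only the coefficient of
    degree n counts. *)
Lemma bform_lagdet n (p : {poly R}) : (size p <= n.+1)%N ->
  form (lagdet G Rg alpha n) p = p`_n * form (lagdet G Rg alpha n) 'X^n.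
Proof.
move=> pn; rewrite [in LHS](_ : p = \sum_(k < n.+1) p`_k *: 'X^k).
  rewrite linear_sum big_ord_recr /= linearZ big1 ?add0r // => k _.
  by rewrite linearZ /= bformXn_lagdet_eq0 ?mulr0.
rewrite -poly_def; apply/polyP => i; rewrite coef_poly.
by case: ltnP => // h; rewrite nth_default // (leq_trans pn).
Qed.

End Lagdet.

Theorem theorem3p2 (R : realType) (G : seq nat) (Rg : nat -> {poly R})
    (alpha : R) (w kappa : nat -> nat -> R)
    (Gsorted : sorted ltn G)
    (Gneq0 : (1 <= size G)%N)
    (Gpos : forall g : nat, g \in G -> (0 < g)%N)
    (Rg_deg : forall g : nat, g \in G -> size (Rg g) = g.+1)
    (Rg_lead : forall g : nat, g \in G -> lead_coef (Rg g) = (g`!%:R)^-1)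
    (Rg_w : is_binomial_coeffs G Rg w)
    (alphaG : forall k : nat, alpha - (maxG G)%:R <> - k%:R)
    (Omega_neq0 : forall n : nat, Omega G Rg n%:R <> 0)
    (kappa_eq0 : forall i : nat, (i < size G)%N ->
       forall j : nat, (1 <= j <= size G - 1 - i)%N ->
       \sum_(g <- G) kappa g i * (Rg g).[- j%:R] = 0)
    (kappa_neq0 : forall i : nat, (i < size G)%N ->
       \sum_(g <- G) kappa g i * (Rg g).[- (size G)%:R + i%:R] <> 0) :
  forall n : nat,
    (forall i : nat, (i < n)%N ->
       bform G alpha w kappa (lagdet G Rg alpha n) (lagdet G Rg alpha i) = 0)
    /\ bform G alpha w kappa (lagdet G Rg alpha n) (lagdet G Rg alpha n) <> 0.
Proof.
move=> n; split=> [i lt_in|].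
  have si := leq_trans (size_lagdet G Rg alpha i) lt_in.
  by rewrite bform_lagdet ?(leq_trans si) // nth_default ?mul0r.
apply/eqP; rewrite bform_lagdet ?size_lagdet // mulf_neq0 ?lead_lagdet //.
exact: bformXn_lagdet_neq0.
Qed.
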